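(* Let $h$ be a positive definite form in $\mathcal H$ with associated positive definite operator $H$, let $X:\mathbb C^n\to\mathcal H$ be an isometry with $\operatorname{ran}(X)\subset\mathcal Q(h)$, and let $h'$ be the block diagonal part of $h$ with respect to $\operatorname{ran}(X)$. Put $\sin\Theta:=\sin\Theta(H^{1/2}X,H^{-1/2}X)$, the sine of the maximal canonical angle between the subspaces $H^{1/2}\operatorname{ran}(X)$ and $H^{-1/2}\operatorname{ran}(X)$. If $\sin\Theta<1$, then for all $u\in\mathcal Q(h)$ $$(1-\sin\Theta)\,h'[u]\le h[u]\le(1+\sin\Theta)\,h'[u],$$ $$\Big(1-\frac{\sin\Theta}{1-\sin\Theta}\Big)h[u]\le h'[u]\le\Big(1+\frac{\sin\Theta}{1-\sin\Theta}\Big)h[u].$$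
   Context: $\mathcal H$ is a Hilbert space. A form $h$ with domain $\mathcal Q(h)$ dense in $\mathcal H$ is called positive definite if it is closed, symmetric and there is $m_h>0$ with $h[u]:=h(u,u)\ge m_h\|u\|^2$ for $u\in\mathcal Q(h)$. Its associated operator $H$ is the selfadjoint operator with $\mathcal D(H^{1/2})=\mathcal Q(h)$ and $h(u,v)=(H^{1/2}u,H^{1/2}v)$ for $u,v\in\mathcal Q(h)$. With $P=XX^*$ (the orthogonal projection onto $\operatorname{ran}(X)$), the block diagonal part of $h$ is $h'(u,v)=h(Pu,Pv)+h((I-P)u,(I-P)v)$, $u,v\in\mathcal Q(h)$. For finite dimensional subspaces with orthogonal projections $P_1,P_2$, the maximal canonical angle is $\Theta=\arcsin\max\{\|P_1(I-P_2)\|,\|P_2(I-P_1)\|\}$. *)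

(* Defs.v *)
From HB Require Import structures.
From mathcomp Require Import all_boot all_order all_algebra.
From mathcomp Require Export complex.
From mathcomp Require Import all_classical all_reals all_analysis.
Import Order.TTheory GRing.Theory Num.Theory.
Import numFieldNormedType.Exports.

Set Implicit Arguments.
Unset Strict Implicit.
Unset Printing Implicit Defensive.

Local Open Scope classical_set_scope.
Local Open Scope ring_scope.
Local Open Scope complex_scope.

(* The inner product is linear in its first argument and conjugate-linear in
   the second one, as for any {dot _ for _}. *)
HB.mixin Record NormedModule_isHilbert (R : realType) V
    of CompleteNormedModule R[i] V := {
  inner : {dot V for (@Num.conj R[i])} ;
  inner_normE : forall u : V, inner u u = `|u| ^+ 2
}.

#[short(type="hilbertType")]
HB.structure Definition Hilbert (R : realType) :=
  {V of CompleteNormedModule R[i] V & NormedModule_isHilbert R V}.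

Definition linear_subspace (K : nzRingType) (U : lmodType K) (M : set U) :=
  M 0 /\ forall (a : K) (u v : U), M u -> M v -> M (a *: u + v).

Section Hilbert.
Context {R : realType} {V : hilbertType R}.
Implicit Types (M N : set V) (A S : set (V * V)).

(* Total by choice; meaningful as soon as M is a complete (e.g. a finite
   dimensional) subspace. *)
Definition orthproj M (u : V) : V :=
  xget 0 [set p | M p /\ forall m, M m -> inner (u - p) m = 0].

Definition opnorm (T : V -> V) : R :=
  sup [set complex.Re `|T u| | u in [set u : V | `|u| <= 1]].

Definition max_canonical_angle M N : R :=
  asin (Num.max (opnorm (fun u => orthproj M (u - orthproj N u)))
                (opnorm (fun u => orthproj N (u - orthproj M u)))).

(* Unbounded operators are identified with their graphs in V * V; the
   composition \; and the inverse ^-1 are those of relations. *)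
Definition is_operator A :=
  linear_subspace A /\ forall u v w, A (u, v) -> A (u, w) -> v = w.

Definition op_dom A : set V := [set u | exists v, A (u, v)].

Definition op_image A M : set V := [set v | exists2 u, M u & A (u, v)].

Definition adjoint A : set (V * V) :=
  [set vw | forall u Au, A (u, Au) -> inner Au vw.1 = inner u vw.2].

Definition selfadjoint A :=
  [/\ is_operator A, dense (op_dom A) & adjoint A = A].

Definition nonnegative_op A := forall u Au, A (u, Au) -> 0 <= inner Au u.

(* The nonnegative selfadjoint square root, by definite description; the
   default set0 is not an operator, its domain being empty. *)
Definition sqrt_op A : set (V * V) :=
  xget set0 [set S | [/\ selfadjoint S, nonnegative_op S
                       & (S \; S)%relation = A]].

Definition op_inv A : set (V * V) := (A^-1)%relation.

End Hilbert.

(* The values of fval outside fdom are irrelevant. *)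
Record sesqform (R : realType) (V : hilbertType R) := SesqForm {
  fdom : set V ;
  fval :> V -> V -> R[i]
}.

Section Forms.
Context {R : realType} {V : hilbertType R}.
Implicit Type h : sesqform V.

Definition sesquilinear_on_dom h :=
  [/\ linear_subspace (fdom h),
      forall (a : R[i]) u v w, fdom h u -> fdom h v -> fdom h w ->
        h (a *: u + v) w = a * h u w + h v w
    & forall (a : R[i]) u v w, fdom h u -> fdom h v -> fdom h w ->
        h w (a *: u + v) = a^* * h w u + h w v].

Definition symmetric_sesqform h :=
  forall u v, fdom h u -> fdom h v -> h u v = (h v u)^*.

Definition closed_sesqform h :=
  forall (w : nat -> V) (u : V), (forall k, fdom h (w k)) ->
    w @ \oo --> u ->
    (fun jk : nat * nat => h (w jk.1 - w jk.2) (w jk.1 - w jk.2))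
      @ (\oo, \oo) --> (0 : (R[i] : numFieldType)) ->
    fdom h u /\ (fun k => h (w k - u) (w k - u)) @ \oo --> (0 : (R[i] : numFieldType)).

Definition positive_definite h :=
  [/\ sesquilinear_on_dom h, dense (fdom h), closed_sesqform h,
      symmetric_sesqform h
    & exists2 m : R, 0 < m & forall u, fdom h u -> m%:C * `|u| ^+ 2 <= h u u].

Definition associated_operator h (H : set (V * V)) :=
  [/\ selfadjoint H, op_dom (sqrt_op H) = fdom h
    & forall u v Su Sv, sqrt_op H (u, Su) -> sqrt_op H (v, Sv) ->
        h u v = inner Su Sv].

Definition block_diag h (M : set V) : sesqform V :=
  SesqForm (fdom h) (fun u v =>
    h (orthproj M u) (orthproj M v)
    + h (u - orthproj M u) (v - orthproj M v)).

Definition isometric n (X : 'cV[R[i]]_n -> V) :=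
  forall a, `|X a| ^+ 2 = \sum_(i < n) `|a i 0| ^+ 2.

End Forms.

(* Main.v *)
(* Write u = p + q with p = P u, and S = H^{1/2}; then h[u] - h'[u] is
   2 Re (S p, S q), where S p lies in M = S (ran X). Since q is orthogonal to
   ran X, S q is orthogonal to N = S^{-1} (ran X), so that
   (S p, S q) = (S p, P_M (I - P_N) S q), which is at most
   sin Theta |S p| |S q| <= sin Theta h'[u] / 2. The relative bounds with respect
   to h follow from those with respect to h'. *)

Require Import Defs.
From mathcomp Require Import all_boot all_order all_algebra.
From mathcomp Require Import all_classical all_reals all_analysis.
From mathcomp Require Import ring lra.
Import Order.TTheory GRing.Theory Num.Theory.
Import numFieldNormedType.Exports.

Set Implicit Arguments.
Unset Strict Implicit.
Unset Printing Implicit Defensive.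

Local Open Scope classical_set_scope.
Local Open Scope ring_scope.
Local Open Scope complex_scope.

(** * Orthogonal projections onto finite dimensional subspaces *)

Section OrthogonalProjection.
Context {R : realType} {V : hilbertType R}.
Implicit Types (M : set V) (u v p : V).

Lemma inner_eq0C u v : inner u v = 0 -> inner v u = 0.
Proof. by move/eqP; rewrite herm_eq0C => /eqP. Qed.

Lemma le_norm_inner u v : (`|u| <= `|v|) = (inner u u <= inner v v).
Proof. by rewrite !inner_normE ler_sqr ?nnegrE. Qed.

Lemma linear_subspace_sum (K : nzRingType) (U : lmodType K) (M : set U)
    (I : Type) (r : seq I) (c : I -> K) (f : I -> U) :
  linear_subspace M -> (forall i, M (f i)) -> M (\sum_(i <- r) c i *: f i).
Proof.
move=> [M0 Mlin] Mf; elim: r => [|i r IHr]; first by rewrite big_nil.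
by rewrite big_cons; apply: Mlin.
Qed.

(** The difference of two candidates lies in [M] and is orthogonal to [M], hence to itself. *)
Lemma orthproj_unique M u p : linear_subspace M -> M p ->
  (forall m, M m -> inner (u - p) m = 0) -> orthproj M u = p.
Proof.
move=> [_ Mlin] Mp up; apply: xget_subset1 => // q r [Mq uq] [Mr ur].
have Mqr : M (q - r) by rewrite addrC -scaleN1r; apply: Mlin.
have qrE : q - r = (u - r) - (u - q) by rewrite opprB [RHS]addrC addrA subrK.
apply/eqP; rewrite -subr_eq0 -(dnorm_eq0 inner) {1}qrE linearBl.
by rewrite /= uq // ur // subr0.
Qed.

Lemma orthproj_orth M u : linear_subspace M ->
  (forall m, M m -> inner u m = 0) -> orthproj M u = 0.
Proof.
by move=> Mlin uM; apply: orthproj_unique => //;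
  [case: Mlin | move=> m; rewrite subr0; apply: uM].
Qed.

(* When [M] is not complete the projection may be the default value 0, for
   which both bounds still hold. *)
Lemma orthproj_contraction M u :
  `|orthproj M u| <= `|u| /\ `|u - orthproj M u| <= `|u|.
Proof.
rewrite /orthproj; case: xgetP => [p _ [Mp up]|_]; last first.
  by rewrite subr0 normr0 normr_ge0.
have := hnormDd (up p Mp); rewrite subrK => uE.
by rewrite !le_norm_inner uE lerDl lerDr !dnorm_ge0.
Qed.

(** Induction on [n]: clear both [u] and [y ord0] of the other vectors, leaving [u1] and [f], then
    remove from [u1] its component along [f]. The family may be linearly dependent. *)
Lemma gram_schmidt n (y : 'I_n -> V) u :
  exists c : 'I_n -> R[i], forall j, inner (u - \sum_i c i *: y i) (y j) = 0.
Proof.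
elim: n y u => [|n IHn] y u; first by exists (fun=> 0) => -[].
pose y' i := y (lift ord0 i).
have [c1 c1P] := IHn y' u; have [c2 c2P] := IHn y' (y ord0).
set u1 := u - _ in c1P; set f := y ord0 - _ in c2P.
pose a := inner u1 f / inner f f.
exists (fun i => oapp (fun j => c1 j - a * c2 j) a (unlift ord0 i)).
rewrite big_ord_recl unlift_none /=.
under eq_bigr => i _ do rewrite liftK /= scalerBl -scalerA.
rewrite sumrB -scaler_sumr.
set s2 := \sum_i c2 i *: _; set s1 := \sum_i c1 i *: _.
have -> : u - (a *: y ord0 + (s1 - a *: s2)) = u1 - a *: f.
  by rewrite /u1 /f scalerBr -addrA -opprD [in RHS]addrCA.
have orth' j : inner (u1 - a *: f) (y' j) = 0.
  by rewrite linearBl linearZl_LR /= c1P c2P mulr0 subr0.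
move=> j; case: (unliftP ord0 j) => [k ->|->]; first exact: orth'.
rewrite -(subrK s2 (y ord0)) -/f linearDr /= linear_sumr big1 ?addr0.
  rewrite linearBl linearZl_LR /= /a.
  (* If [f = 0], then [y ord0] depends on the other vectors and there is nothing left to remove. *)
  have [->|f0] := eqVneq f 0; first by rewrite !linear0r subr0.
  by rewrite [X in _ - X]mulfVK ?subrr // dnorm_eq0.
by move=> i _; rewrite linearZr_LR /= orth' mulr0.
Qed.

(** A finite spanning family provides a candidate, so the choice in [orthproj] does not fall back on
    its default 0. *)
Lemma orthproj_span M n (y : 'I_n -> V) u : linear_subspace M ->
    (forall i, M (y i)) ->
    (forall m, M m -> exists c : 'I_n -> R[i], m = \sum_i c i *: y i) ->
  M (orthproj M u) /\ forall m, M m -> inner (u - orthproj M u) m = 0.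
Proof.
move=> Mlin My My'.
apply: (@xgetPex _ 0 [set p | M p /\ forall m, M m -> inner (u - p) m = 0]).
have [c cP] := gram_schmidt y u; exists (\sum_i c i *: y i); split.
  exact: linear_subspace_sum.
move=> m /My'[d ->]; rewrite linear_sumr big1 // => i _.
by rewrite linearZr_LR /= cP mulr0.
Qed.

End OrthogonalProjection.

(** * Operator norms and the sine of the maximal canonical angle *)

Section CanonicalAngle.
Context {R : realType} {V : hilbertType R}.
Implicit Types (M N : set V) (u v w : V).

Lemma Re_norm u : (complex.Re `|u|)%:C = `|u|.
Proof. by apply: RRe_real; apply: normr_real. Qed.

(** A [sup] dominates its set only if that set is bounded; for contractions 1 is a bound. *)
Lemma opnorm_ubound (T : V -> V) : (forall u, `|T u| <= `|u|) ->
  ubound [set complex.Re `|T u| | u in [set u : V | `|u| <= 1]] 1.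
Proof.
move=> Tle _ [u /= u1 <-].
by rewrite -lecR Re_norm (le_trans (Tle u)).
Qed.

Lemma le_opnorm (T : V -> V) u : (forall u, `|T u| <= `|u|) ->
  `|u| <= 1 -> `|T u| <= (opnorm T)%:C.
Proof.
move=> Tle u1; rewrite -Re_norm lecR; apply: ub_le_sup.
  by exists 1; apply: opnorm_ubound.
by exists u.
Qed.

Lemma opnorm_le1 (T : V -> V) : (forall u, `|T u| <= `|u|) ->
  0 <= opnorm T <= 1.
Proof.
move=> Tle; apply/andP; split.
  by rewrite -lecR (le_trans _ (le_opnorm Tle (_ : `|0| <= 1))) ?normr0 ?ler01.
apply: ge_sup; last exact: opnorm_ubound.
by exists (complex.Re `|T 0|), 0; rewrite //= normr0 ler01.
Qed.

Lemma orthproj_orthproj_le M N u : `|orthproj M (u - orthproj N u)| <= `|u|.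
Proof.
have [+ _] := orthproj_contraction M (u - orthproj N u).
by move=> /le_trans; apply; have [] := orthproj_contraction N u.
Qed.

(** [sin] undoes [asin] only on [-1, 1]; both norms lie in [0, 1] because composed projections are
    contractions. *)
Lemma sin_max_canonical_angle M N : sin (max_canonical_angle M N) =
  Num.max (opnorm (fun u => orthproj M (u - orthproj N u)))
          (opnorm (fun u => orthproj N (u - orthproj M u))).
Proof.
apply: asinK; rewrite in_itv /= le_max ge_max.
have /andP[a0 ->] := opnorm_le1 (orthproj_orthproj_le M N).
have /andP[_ ->] := opnorm_le1 (orthproj_orthproj_le N M).
by rewrite andbT (le_trans _ a0) // oppr_le0 ler01.
Qed.

Lemma sin_max_canonical_angle_ge0 M N : 0 <= sin (max_canonical_angle M N).
Proof.
rewrite sin_max_canonical_angle le_max.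
by have /andP[->] := opnorm_le1 (orthproj_orthproj_le M N).
Qed.

(** As [w] is orthogonal to [N], its projection onto [N] vanishes, so P_M w = P_M (I - P_N) w. *)
Lemma norm_orthproj_le_sin M N w : linear_subspace M -> linear_subspace N ->
    (M (orthproj M w) /\ forall m, M m -> inner (w - orthproj M w) m = 0) ->
    (forall v, N v -> inner w v = 0) ->
  `|orthproj M w| <= (sin (max_canonical_angle M N))%:C * `|w|.
Proof.
move=> Mlin Nlin [Mp wp] wN.
have [->|w0] := eqVneq w 0.
  by rewrite orthproj_orth ?normr0 ?mulr0 // => m _; rewrite linear0l.
(* [le_opnorm] covers the unit ball only, so [w] is scaled to norm 1. *)
pose a := `|w|^-1; have a0 : 0 <= a by rewrite invr_ge0.
have projZ : orthproj M (a *: w) = a *: orthproj M w.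
  apply: orthproj_unique => //; last first.
    by move=> m Mm; rewrite -scalerBr linearZl_LR /= wp // mulr0.
  by case: Mlin => M0 Mlin; rewrite -[_ *: _]addr0; apply: Mlin.
have := @le_opnorm (fun u => orthproj M (u - orthproj N u)) (a *: w)
  (orthproj_orthproj_le M N).
rewrite (@orthproj_orth _ _ N) //; last first.
  by move=> v Nv; rewrite linearZl_LR /= wN // mulr0.
rewrite subr0 projZ !normrZ ger0_norm // mulVf ?normr_eq0 // lexx.
rewrite mulrC ler_pdivrMr ?normr_gt0 // => /(_ isT) /le_trans; apply.
by rewrite ler_wpM2r // lecR sin_max_canonical_angle le_max lexx.
Qed.

End CanonicalAngle.

(** With t = 2 Re (x, z) the cross term, s t = 2 Re (s x, z) is at most s^2 |x|^2 + |z|^2 <= s^2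
    (|x|^2 + |w|^2) in absolute value; dividing by s gives both bounds. *)
Lemma dnormD_bounds (R : realType) (V : hilbertType R) (x w z : V) (s : R[i]) :
    0 <= s -> inner x w = inner x z -> `|z| <= s * `|w| ->
  (1 - s) * (inner x x + inner w w) <= inner (x + w) (x + w) /\
  inner (x + w) (x + w) <= (1 + s) * (inner x x + inner w w).
Proof.
move=> s0 xwz zw.
have zz : inner z z <= s ^+ 2 * inner w w.
  by rewrite !inner_normE -exprMn ler_sqr ?nnegrE ?mulr_ge0.
have dE : inner (x + w) (x + w)
    = inner x x + inner w w + (inner x w + Num.conj (inner x w)).
  exact: dnormD.
set t := inner x w + _ in dE.
suff [t1 t2] : - (s * (inner x x + inner w w)) <= t
               /\ t <= s * (inner x x + inner w w).
  by rewrite dE mulrBl mulrDl mul1r !lerD2l.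
(* The division by [s] fails at [s = 0], but then [z = 0] and the cross term vanishes. *)
have [s_eq0|sn0] := eqVneq s 0.
  have -> : t = 0.
    have : z = 0 by apply/eqP; rewrite -normr_le0 (le_trans zw) ?s_eq0 ?mul0r.
    by rewrite /t xwz => ->; rewrite linear0r conjC0 addr0.
  by rewrite s_eq0 mul0r oppr0.
have s_gt0 : 0 < s by rewrite lt0r sn0.
have st : inner (s *: x) z + Num.conj (inner (s *: x) z) = s * t.
  rewrite linearZl_LR /= -xwz rmorphM mulrDr; congr (_ + _ * _).
  exact: geC0_conj.
have sx : inner (s *: x) (s *: x) + inner z z
          <= s * (s * (inner x x + inner w w)).
  rewrite dnormZ ger0_norm // mulrA -expr2 mulrDr.
  by rewrite lerD2l.
(* Both bounds say that [s *: x + z] and [s *: x - z] have nonnegative square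
   norm. *)
split; rewrite -(ler_pM2l s_gt0).
  rewrite mulrN lerNl -subr_ge0 opprK.
  have := dnorm_ge0 inner (s *: x + z); rewrite dnormD /= st.
  move=> /le_trans; apply.
  by rewrite lerD2r.
have := dnorm_ge0 inner (s *: x - z); rewrite dnormB /= st.
by rewrite subr_ge0 => /le_trans; apply.
Qed.

(** * Operators as graphs, and the image of ran X under them *)

Section Operators.
Context {R : realType} {V : hilbertType R}.
Implicit Types (A S : set (V * V)) (M : set V).

Lemma linear_subspace_op_image A M :
  linear_subspace A -> linear_subspace M -> linear_subspace (op_image A M).
Proof.
move=> [A0 Alin] [M0 Mlin]; split; first by exists 0.
move=> a v v' [u Mu Auv] [u' Mu' Auv']; exists (a *: u + u'); first exact: Mlin.
exact: (Alin a _ _ Auv Auv').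
Qed.

Lemma linear_subspace_op_inv A :
  linear_subspace A -> linear_subspace (op_inv A).
Proof.
move=> [A0 Alin]; split=> // a [u v] [u' v'] Auv Auv'.
exact: (Alin a (v, u) (v', u')).
Qed.

Lemma linear_subspace_range (U : lmodType R[i]) (X : {linear U -> V}) :
  linear_subspace (range X).
Proof.
split; first by exists 0; rewrite ?linear0.
by move=> a _ _ [u _ <-] [v _ <-]; exists (a *: u + v); rewrite ?linearP.
Qed.

Lemma selfadjoint_inner S u v Su Sv : selfadjoint S ->
  S (u, Su) -> S (v, Sv) -> inner Su v = inner u Sv.
Proof.
by move=> [_ _ SE] uSu vSv; move: vSv; rewrite -{1}SE => /(_ _ _ uSu).
Qed.

(** A nonempty domain rules out the default [set0], so a genuine square root was chosen. *)
Lemma sqrt_op_selfadjoint A : op_dom (sqrt_op A) !=set0 ->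
  selfadjoint (sqrt_op A).
Proof.
by rewrite /sqrt_op; case: xgetP => [S _ [Ssa _ _] _|_ [u [v]]].
Qed.

Lemma linear_cVE n (X : {linear 'cV[R[i]]_n -> V}) a :
  X a = \sum_i a i 0 *: X (delta_mx i 0).
Proof.
rewrite {1}[a]matrix_sum_delta linear_sum; apply: eq_bigr => i _.
by rewrite big_ord1 linearZ.
Qed.

Lemma orthproj_range n (X : {linear 'cV[R[i]]_n -> V}) u :
  range X (orthproj (range X) u) /\
  forall m, range X m -> inner (u - orthproj (range X) u) m = 0.
Proof.
apply: (@orthproj_span _ _ _ _ (fun i => X (delta_mx i 0))).
- exact: linear_subspace_range.
- by move=> i; exists (delta_mx i 0).
- by move=> _ [a _ <-]; exists (fun i => a i 0); apply: linear_cVE.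
Qed.

Lemma orthproj_op_image_range S n (X : {linear 'cV[R[i]]_n -> V}) u :
    is_operator S -> range X `<=` op_dom S ->
  op_image S (range X) (orthproj (op_image S (range X)) u) /\
  forall m, op_image S (range X) m ->
    inner (u - orthproj (op_image S (range X)) u) m = 0.
Proof.
move=> [Slin Sfun] Xdom.
have /choice[y yP] i : exists y, S (X (delta_mx i 0), y).
  by apply: Xdom; exists (delta_mx i 0).
apply: (@orthproj_span _ _ _ _ y).
- exact: linear_subspace_op_image Slin (linear_subspace_range X).
- by move=> i; exists (X (delta_mx i 0)).
move=> m [_ [a _ <-] Sm]; exists (fun i => a i 0); apply: Sfun Sm _.
(* The graph is a subspace of the product, so it contains the combination of the pairs
   [(X (delta_mx i 0), y i)]; single-valuedness then identifies [m]. *)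
have := linear_subspace_sum (index_enum 'I_n) (fun i => a i 0) Slin yP.
by rewrite [X in S X]surjective_pairing !raddf_sum /= -linear_cVE.
Qed.

End Operators.

Theorem theorem4p5 (R : realType) (V : hilbertType R) (h : sesqform V)
    (H : set (V * V)) (n : nat) (X : {linear 'cV[R[i]]_n -> V}) :
  positive_definite h ->
  associated_operator h H ->
  isometric X ->
  range X `<=` fdom h ->
  let h' := block_diag h (range X) in
  let sinTheta : R :=
    sin (max_canonical_angle (op_image (sqrt_op H) (range X))
                             (op_image (op_inv (sqrt_op H)) (range X))) in
  sinTheta < 1 ->
  forall u : V, fdom h u ->
    [/\ (1 - sinTheta)%:C * h' u u <= h u u,
        h u u <= (1 + sinTheta)%:C * h' u u,
        (1 - sinTheta / (1 - sinTheta))%:C * h u u <= h' u u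
      & h' u u <= (1 + sinTheta / (1 - sinTheta))%:C * h u u].
Proof.
move=> _ [_ domS hS] _ Xdom h' s s1 u uQ.
set S := sqrt_op H in domS hS *; set E := range X.
have Ssa : selfadjoint S.
  by apply: sqrt_op_selfadjoint; rewrite -/S domS; exists u.
have [[Slin Sfun] _ _] := Ssa.
have Elin : linear_subspace E := linear_subspace_range X.
have [Ep uE] := orthproj_range X u.
set p := orthproj E u in Ep uE; set q := u - p in uE.
have [Sp Spp] : op_dom S p by rewrite domS; apply: Xdom.
have [Su Suu] : op_dom S u by rewrite domS.
pose Sq := Su - Sp.
have Sqq : S (q, Sq).
  have [_ Slin'] := Slin.
  by have := Slin' (-1) _ _ Spp Suu; rewrite !scaleN1r ![- _ + _]addrC.
have h'E : h' u u = inner Sp Sp + inner Sq Sq.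
  by rewrite /h' /= -/E -/p (hS _ _ _ _ Spp Spp) (hS _ _ _ _ Sqq Sqq).
have hE : h u u = inner (Sp + Sq) (Sp + Sq).
  by rewrite (hS _ _ _ _ Suu Suu) addrC subrK.
set M := op_image S E; set N := op_image (op_inv S) E.
have Mlin : linear_subspace M by apply: linear_subspace_op_image.
have Nlin : linear_subspace N.
  by apply: linear_subspace_op_image => //; apply: linear_subspace_op_inv.
have [Mz zM] : M (orthproj M Sq) /\
    forall m, M m -> inner (Sq - orthproj M Sq) m = 0.
  by apply: orthproj_op_image_range => //; rewrite domS.
(* For [v] in [N] there is [e] in [E] with S v = e, and selfadjointness gives (S q, v) = (q, e) =
   0. *)
have SqN v : N v -> inner Sq v = 0.
  by move=> [e Ee Sve]; rewrite (selfadjoint_inner Ssa Sqq Sve) uE.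
have Sq_le := norm_orthproj_le_sin Mlin Nlin (conj Mz zM) SqN.
have s0 : 0 <= s := sin_max_canonical_angle_ge0 M N.
have SpqE : inner Sp Sq = inner Sp (orthproj M Sq).
  apply/eqP; rewrite -subr_eq0 -linearBr; apply/eqP/inner_eq0C/zM.
  by exists p.
have s0C : 0 <= s%:C by rewrite ler0c.
have [] := dnormD_bounds s0C SpqE Sq_le.
rewrite -h'E -hE.
have h'_ge0 : 0 <= h' u u by rewrite h'E addr_ge0 ?dnorm_ge0.
have h_ge0 : 0 <= h u u by rewrite hE dnorm_ge0.
(* Being nonnegative, both form values are real: [x] is h'[u] and [y] is h[u], and the rest is real
   arithmetic. *)
have /complex_realP[x xE] := ger0_real h'_ge0.
have /complex_realP[y yE] := ger0_real h_ge0.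
rewrite {}xE {}yE in h'_ge0 h_ge0 *.
rewrite ler0c in h'_ge0; rewrite ler0c in h_ge0.
rewrite -[1]/(1%:C) -!rmorphB -!rmorphD -!rmorphM !lecR => lb ub.
have d0 : 0 < 1 - s by rewrite subr_gt0.
split=> //.
  have -> : 1 - s / (1 - s) = (1 - 2 * s) / (1 - s) by field; rewrite gt_eqF.
  rewrite mulrAC ler_pdivrMr //.
  (* For 1 - 2s < 0 the left side is nonpositive. Otherwise y <= (1 + s) x suffices, since (1 -
     2s)(1 + s) = 1 - s - 2s^2 <= 1 - s. *)
  have [s2|s2] := lerP 0 (1 - 2 * s); last first.
    by apply: le_trans (mulr_ge0 h'_ge0 (ltW d0)); rewrite mulr_le0_ge0 // ltW.
  apply: le_trans (ler_wpM2l s2 ub) _.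
  by rewrite mulrA [x * _]mulrC ler_wpM2r //; nra.
(* In this form the bound is (1 - s) x <= y divided by 1 - s. *)
have -> : 1 + s / (1 - s) = (1 - s)^-1 by field; rewrite gt_eqF.
by rewrite mulrC ler_pdivlMr // mulrC.
Qed.
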